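(* Let $N\ge2$ and $F\in GL_N(\mathbb{C})$ be such that $\mathrm{Tr}(F^*F)=\mathrm{Tr}((F^*F)^{-1})$, and define $0<q\le1$ by $q+q^{-1}=\mathrm{Tr}(F^*F)$. Then $\omega(R(U_F^+))=r_q>1$, where $r_q$ is the largest real root of the polynomial $P_q(z)=z^3-(2q^{-2}+3+2q^2)z^2+2(q^{-2}+1+q^2)z-2$. In particular $R(U_F^+)$ has uniform exponential growth (i.e. $\omega(R(U_F^+))>1$).
   Context: A fusion algebra $(R,d)$ consists of a set $I$ with distinguished $e$ and involution $\alpha\mapsto\bar\alpha$, a unital ring structure on $R=\mathbb{Z}[I]$ with unit $e$ and $\xi\eta=\sum_\alpha N^\alpha_{\xi,\eta}\alpha$, $N^\alpha_{\xi,\eta}\in\mathbb{Z}_{\ge0}$ finitely many nonzero, the involution extending to a $\mathbb{Z}$-linear antimultiplicative involution with Frobenius reciprocity $N^\alpha_{\xi,\eta}=N^\xi_{\alpha,\bar\eta}=N^\eta_{\bar\xi,\alpha}$, and a $\mathbb{Z}$-linear multiplicative $d:R\to\mathbb{R}$ with $d(\bar\alpha)=d(\alpha)\ge1$ on $I$. Write $\alpha\subseteq r$ if $\alpha$ has nonzero coefficient in $r$; $|A|=\sum_{\alpha\in A}d(\alpha)^2$. A finite generating set is a finite $X\subseteq I$, $\bar X=X$, such that each $\alpha\in I$ satisfies $\alpha\subseteq x_1\cdots x_n$ for some $x_i\in X$; $\ell_X(e)=0$ and $\ell_X(\alpha)$ is the least such $n\ge 1$ otherwise; $B_X(n)=\{\alpha:\ell_X(\alpha)\le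 n\}$; $\omega_X(R,d)=\lim_n|B_X(n)|^{1/n}$ (exists) and $\omega(R,d)=\inf_X\omega_X(R,d)$ over finite generating sets. $R(U_F^+)$ denotes the fusion algebra of the free unitary quantum group $U_F^+$ with its quantum dimension. Concretely (Banica): $I$ is the free monoid on two letters $\alpha,\bar\alpha$ ($\alpha$ the fundamental representation, $e$ the empty word), the involution reverses a word and interchanges $\alpha\leftrightarrow\bar\alpha$, and the product is $x\cdot y=\sum_{a,b,c:\ x=ac,\ y=\bar c b} ab$. For $n\ge1$ let $w^n_{+1}=\alpha\bar\alpha\alpha\cdots$ and $w^n_{-1}=\bar\alpha\alpha\bar\alpha\cdots$ ($n$ letters); every nonempty word is uniquely a concatenation of maximal alternating blocks $w^{k_1}_{\varepsilon_1}\cdots w^{k_m}_{\varepsilon_m}$, and its quantum dimension is $[k_1+1]_q\cdots[k_m+1]_q$, where $[x]_q=\frac{q^{-x}-q^x}{q^{-1}-q}$ for $q<1$ and $[x]_1=x$. *)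

(* Defs.v *)
From HB Require Import structures.
From mathcomp Require Import all_boot all_order all_algebra.
From mathcomp Require Import all_classical all_reals.
From mathcomp Require Import topology normedtype sequences exp.
From mathcomp Require Import complex.
Set Implicit Arguments. Unset Strict Implicit. Unset Printing Implicit Defensive.
Import Order.TTheory GRing.Theory Num.Theory.
Import numFieldNormedType.Exports.
Local Open Scope ring_scope.

(* The index set I of R(U_F^+): the free monoid on {alpha, alpha-bar}. *)
(* A word is a seq bool: true = alpha (fundamental rep.), false =      *)
(* alpha-bar; the empty word [::] is the unit e.                       *)
Definition word := seq bool.

Definition wbar (w : word) : word := rev (map negb w).

(* Banica's fusion rule  x . y = sum_{x = a c, y = cbar b} a b ,
   returned as the multiset (list with multiplicities) of the words a b.
   The decompositions are indexed by the length k = |c| of c. *)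
Definition fus (x y : word) : seq word :=
  [seq take (size x - k) x ++ drop k y
  | k <- iota 0 (minn (size x) (size y)).+1
  & drop (size x - k) x == wbar (take k y)].

(* product of an element of Z_{>=0}[I] (a multiset of words) by a word *)
Definition fusl (r : seq word) (y : word) : seq word :=
  flatten [seq fus x y | x <- r].

Definition fprod (xs : seq word) : seq word := foldl fusl [:: [::]] xs.

Definition subprod (a : word) (xs : seq word) : bool := a \in fprod xs.

Fixpoint seqs_of (X : seq word) (m : nat) : seq (seq word) :=
  if m is m'.+1 then [seq x :: s | x <- X, s <- seqs_of X m'] else [:: [::]].

Definition gen_set (X : seq word) : Prop :=
  (forall x, x \in X -> wbar x \in X) /\
  (forall a : word, exists xs : seq word,
      all (fun x => x \in X) xs /\ subprod a xs).

(* B_X(n) = { alpha : l_X(alpha) <= n }: the unit e (l_X(e) = 0) together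
   with all alpha contained in some product x_1..x_m, 1 <= m <= n, x_i in X
   (listed without repetition). *)
Definition ballX (X : seq word) (n : nat) : seq word :=
  undup ([:: [::]] ++
    flatten [seq flatten [seq fprod xs | xs <- seqs_of X m] | m <- iota 1 n]).

Fixpoint blocks_aux (a : bool) (k : nat) (t : word) : seq nat :=
  match t with
  | [::] => [:: k]
  | b :: t' => if b == a then k :: blocks_aux b 1 t'
               else blocks_aux b k.+1 t'
  end.
Definition blocks (w : word) : seq nat :=
  if w is a :: t then blocks_aux a 1 t else [::].

Section QDim.
Variable R : realType.

Definition qnum (q : R) (x : nat) : R :=
  if q < 1 then (q ^- x - q ^+ x) / (q^-1 - q) else x%:R.

Definition qdim (q : R) (w : word) : R :=
  \prod_(k <- blocks w) qnum q k.+1.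

Definition vol (q : R) (A : seq word) : R := \sum_(a <- A) qdim q a ^+ 2.

Definition omegaX (q : R) (X : seq word) : R :=
  limn (fun n : nat => powR (vol q (ballX X n)) (n%:R^-1)).

Definition omega (q : R) : R :=
  inf [set omegaX q X | X in [set X : seq word | gen_set X]].

Definition Pq (q z : R) : R :=
  z ^+ 3 - (2 * q ^- 2 + 3 + 2 * q ^+ 2) * z ^+ 2
  + 2 * (q ^- 2 + 1 + q ^+ 2) * z - 2.

Definition largest_real_root (q r : R) : Prop :=
  Pq q r = 0 /\ forall z : R, Pq q z = 0 -> z <= r.

End QDim.

Definition adjmx (R : realType) (m n : nat) (F : 'M[R[i]]_(m, n)) : 'M[R[i]]_(n, m) :=
  map_mx (@conjc R) F^T.

(* Main.v *)
(* Weighting words by [qdim ^+ 2], the volume of the words of length n satisfies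
   a linear recursion (on the length of the current alternating block) with a
   positive eigenvector of eigenvalue r exactly when [Pq q r = 0]; hence the ball
   of radius n for the generators alpha, alpha-bar has volume of order r^n.
   For an arbitrary finite generating set X, parity of lengths provides some
   x in X of odd length. Then x <> x-bar, so substituting x for alpha and x-bar
   for alpha-bar is injective on words; it sends words of length n into the X-ball
   of radius n, and it does not decrease the quantum dimension: either x alternates,
   and then blocks only get longer, or x has a doubled letter, and then the image
   has dimension at least [2]^n. So no X grows more slowly than r^n. The limits
   defining [omegaX] exist by Fekete's lemma, balls being submultiplicative. *)
Require Import Defs.
From HB Require Import structures.
From mathcomp Require Import all_boot all_order all_algebra.
From mathcomp Require Import all_classical all_reals.
From mathcomp Require Import topology normedtype sequences exp.
From mathcomp Require Import complex.
From mathcomp Require Import ring lra.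
Import Order.TTheory GRing.Theory Num.Theory.
Import numFieldNormedType.Exports.
Local Open Scope ring_scope.
Set Implicit Arguments. Unset Strict Implicit. Unset Printing Implicit Defensive.

(** * Conjugation of words and the fusion rule *)

Lemma size_wbar w : size (wbar w) = size w.
Proof. by rewrite size_rev size_map. Qed.

Lemma wbarK : involutive wbar.
Proof.
by move=> w; rewrite /wbar map_rev revK -map_comp map_id_in // => b _ /=; rewrite negbK.
Qed.

Lemma wbar_cat u v : wbar (u ++ v) = wbar v ++ wbar u.
Proof. by rewrite /wbar map_cat rev_cat. Qed.

Lemma fusP x y z :
  reflect (exists u c v, [/\ x = u ++ c, y = wbar c ++ v & z = u ++ v])
          (z \in fus x y).
Proof.
apply: (iffP mapP) => [[k]|[u [c [v [-> -> ->]]]]].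
  rewrite mem_filter mem_iota add0n ltnS leq_min => /andP[/eqP xc /andP[_ /andP[kx ky]]] ->.
  exists (take (size x - k) x), (wbar (take k y)), (drop k y); split => //.
    by rewrite -xc cat_take_drop.
  by rewrite wbarK cat_take_drop.
exists (size c).
  rewrite mem_filter mem_iota !size_cat addnK drop_size_cat // size_wbar.
  by rewrite take_size_cat ?size_wbar // wbarK eqxx add0n ltnS leq_min leq_addl leq_addr.
by rewrite !size_cat addnK take_size_cat // drop_size_cat // size_wbar.
Qed.

(** Associativity of supports. The second cancellation either stays inside [y], or uses up what is
    left of [y] and reaches into [x]; comparing the lengths of [u] and [p] decides which. *)
Lemma fus_assoc x y z b a : b \in fus x y -> a \in fus b z ->
  exists2 c, c \in fus y z & a \in fus x c.
Proof.
move=> /fusP[u [c [v [-> -> ->]]]] /fusP[p [d [w [uvpd -> ->]]]].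
have [le_up|lt_pu] := leqP (size u) (size p).
  have puv : p = u ++ drop (size u) p.
    rewrite -{1}(cat_take_drop (size u) p); congr (_ ++ _).
    by have := congr1 (take (size u)) uvpd; rewrite take_size_cat // takel_cat.
  move: uvpd; rewrite puv -catA => /eqP; rewrite eqseq_cat // eqxx /= => /eqP ->.
  exists (wbar c ++ drop (size u) p ++ w).
    by apply/fusP; exists (wbar c ++ drop (size u) p), d, w; rewrite !catA.
  by apply/fusP; exists u, c, (drop (size u) p ++ w); rewrite -catA.
have upv : u = p ++ drop (size p) u.
  rewrite -{1}(cat_take_drop (size p) u); congr (_ ++ _).
  by have := congr1 (take (size p)) uvpd; rewrite takel_cat ?(ltnW lt_pu) // take_size_cat.
move: uvpd; rewrite upv -catA => /eqP; rewrite eqseq_cat // eqxx /= => /eqP <-.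
exists (wbar c ++ wbar (drop (size p) u) ++ w).
  apply/fusP; exists (wbar c), v, (wbar (drop (size p) u) ++ w).
  by rewrite wbar_cat catA.
by apply/fusP; exists p, (drop (size p) u ++ c), w; rewrite wbar_cat !catA.
Qed.

Lemma fus1l y : fus [::] y = [:: y].
Proof. by rewrite /fus min0n /= take0 eqxx /= drop0. Qed.

Lemma fus1r x : fus x [::] = [:: x].
Proof. by rewrite /fus minn0 /= subn0 drop_size eqxx /= subn0 take_size cats0. Qed.

(** Either nothing cancels, or the two letters at the junction cancel and the rest happens between
    [x] and [y]. This permits induction from the junction outwards. *)
Lemma fus_rcons_cons x a b y :
  fus (rcons x a) (b :: y) =
  (rcons x a ++ b :: y) :: (if b == ~~ a then fus x y else [::]).
Proof.
rewrite /fus size_rcons [size (_ :: _)]/= minnSS.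
set m := minn _ _; rewrite -[iota 0 m.+2]/(0%N :: iota (1 + 0) m.+1) iotaDl.
move: (iota 0 m.+1) => s; rewrite [LHS]/= subn0.
rewrite [drop _ _]drop_oversize ?size_rcons //= subn0 take_oversize ?size_rcons //.
congr cons; rewrite filter_map -map_comp.
have E k : (drop ((size x).+1 - k.+1) (rcons x a) == wbar (take k.+1 (b :: y)))
    = (b == ~~ a) && (drop (size x - k) x == wbar (take k y)).
  rewrite subSS drop_rcons ?leq_subr //= /wbar /= rev_cons eqseq_rcons andbC.
  by rewrite -(inj_eq negb_inj) negbK eq_sym.
rewrite (eq_filter E); case: (b == ~~ a); last by rewrite filter_pred0.
by apply: eq_map => k /=; rewrite subSS -cats1 takel_cat ?leq_subr.
Qed.

(* The dimension of [t] preceded by an alternating block of [k] letters ending in [a]. *)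
Definition bdim (R : realType) (q : R) (a : bool) (k : nat) (t : word) : R :=
  \prod_(j <- blocks_aux a k t) qnum q j.+1.

(** * Quantum numbers and multiplicativity of the quantum dimension *)

Section QuantumNumbers.
Variables (R : realType) (q : R).
Hypotheses (q_gt0 : 0 < q) (q_le1 : q <= 1).

Lemma qnum0 : qnum q 0 = 0.
Proof. by rewrite /qnum expr0 invr1 subrr mul0r if_same. Qed.

Lemma qnum_denom : q < 1 -> q^-1 - q != 0.
Proof.
by move=> q1; rewrite subr_eq0 gt_eqF // (lt_trans q1) // invf_gt1.
Qed.

Lemma qnum1 : qnum q 1 = 1.
Proof.
by rewrite /qnum; case: ifP => // /qnum_denom q1; rewrite !expr1 divff.
Qed.

(** The Chebyshev recursion, common to [q < 1] and [q = 1]; with the values at 0 and 1 it replaces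
    the definition from here on. *)
Lemma qnumSS n : qnum q n.+2 = (q + q^-1) * qnum q n.+1 - qnum q n.
Proof.
rewrite /qnum; case: ifPn => [/qnum_denom q1|].
  have q0 := lt0r_neq0 q_gt0; rewrite -!exprVn !exprS.
  have qn : q ^+ n * q^-1 ^+ n = 1 by rewrite -exprMn divff // expr1n.
  have qq : q * q^-1 = 1 by rewrite divff.
  rewrite [in RHS]mulrA -mulrBl; congr (_ / _).
  by ring: qq.
rewrite -leNgt => q1; have -> : q = 1 by apply/le_anti; rewrite q_le1.
by rewrite invr1 -[n.+2]addn2 -[n.+1]addn1 !natrD; ring.
Qed.

Lemma qnum2 : qnum q 2 = q + q^-1.
Proof. by rewrite qnumSS qnum1 qnum0; ring. Qed.

Lemma qnum2_ge2 : 2 <= qnum q 2.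
Proof.
rewrite qnum2 -subr_ge0.
have -> : q + q^-1 - 2 = (q - 1) ^+ 2 / q by field; exact: lt0r_neq0.
by rewrite divr_ge0 ?sqr_ge0 // ltW.
Qed.

(** Joint induction: since [[2] >= 2], the recursion gives [[n+2] - [n+1] >= [n+1] - [n]]. *)
Lemma qnumS_ge n : 0 <= qnum q n /\ qnum q n + 1 <= qnum q n.+1.
Proof.
elim: n => [|n [n0 nS]]; first by rewrite qnum0 qnum1 add0r.
have t2 := qnum2_ge2; split; first by lra.
by rewrite (qnumSS n) -qnum2; nra.
Qed.

Lemma qnum_ge0 n : 0 <= qnum q n.
Proof. by have [] := qnumS_ge n. Qed.

Lemma qnum_leS n : qnum q n <= qnum q n.+1.
Proof. by have [_] := qnumS_ge n; lra. Qed.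

Lemma qnum_le : {homo qnum q : m n / (m <= n)%N >-> m <= n}.
Proof. by apply: homo_leq => // [x y z|n]; [exact: le_trans|exact: qnum_leS]. Qed.

Lemma qnum_ge1 n : 1 <= qnum q n.+1.
Proof. by have [? ?] := qnumS_ge n; lra. Qed.

(* The Clebsch-Gordan rule for the irreducible corepresentations of SU_q(2). *)
Lemma qnum_mul k l :
  qnum q k.+1 * qnum q l.+2 = qnum q (k + l).+2 + qnum q k * qnum q l.+1.
Proof.
elim: k l => [|k IHk] l; first by rewrite qnum1 qnum0 mul1r mul0r addr0.
have := IHk l.+1; rewrite addSn addnS (qnumSS l.+1) (qnumSS k).
lra.
Qed.

Lemma qnum_leM k l : qnum q (k + l).+1 <= qnum q k.+1 * qnum q l.+1.
Proof.
case: l => [|l]; first by rewrite addn0 qnum1 mulr1.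
by rewrite qnum_mul addnS lerDl mulr_ge0 ?qnum_ge0.
Qed.

Lemma bdim_cons a k b t : bdim q a k (b :: t) =
  if b == a then qnum q k.+1 * bdim q b 1 t else bdim q b k.+1 t.
Proof. by rewrite /bdim /=; case: ifP; rewrite ?big_cons. Qed.

Lemma bdim_nil a k : bdim q a k [::] = qnum q k.+1.
Proof. by rewrite /bdim big_seq1. Qed.

Lemma qdim_nil : qdim q [::] = 1.
Proof. by rewrite /qdim big_nil. Qed.

Lemma qdim_cons a t : qdim q (a :: t) = bdim q a 1 t.
Proof. by []. Qed.

Lemma bdim0 b w : bdim q b 0 w = qdim q w.
Proof.
case: w => [|a w]; first by rewrite bdim_nil qnum1 qdim_nil.
by rewrite bdim_cons qdim_cons qnum1 mul1r if_same.
Qed.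

(** Only the first block feels [j]: [l] counts the letters of [y] that prolong it, and [e] is the
    contribution of the later blocks. *)
Lemma bdim_head b y :
  exists l e, forall j, bdim q b j y = qnum q (j + l).+1 * e.
Proof.
elim: y b => [|a y IHy] b.
  by exists 0%N, 1 => j; rewrite bdim_nil addn0 mulr1.
have [eq_ab|ne_ab] := boolP (a == b).
  exists 0%N, (bdim q a 1 y) => j.
  by rewrite bdim_cons eq_ab addn0.
have [l [e E]] := IHy a; exists l.+1, e => j.
by rewrite bdim_cons (negbTE ne_ab) E addSnnS.
Qed.

(** Here [k] is the length of the last block of [rcons x a] and [c] the contribution of the earlier
    ones; dropping [a] shortens that block by one, whence the factor [qnum q k]. *)
Lemma bdim_tail x a : exists c k, qdim q x = c * qnum q k /\
  forall t, qdim q (rcons x a ++ t) = c * bdim q a k t.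
Proof.
elim/last_ind: x a => [|x b IHx] a.
  by exists 1, 1%N; rewrite qdim_nil qnum1 mul1r; split => // t; rewrite mul1r.
have [c [k [_ E]]] := IHx b.
have Ex : qdim q (rcons x b) = c * qnum q k.+1.
  by rewrite -[rcons x b]cats0 E bdim_nil.
have [/eqP eq_ab|ne_ab] := boolP (a == b).
  exists (c * qnum q k.+1), 1%N; rewrite qnum1 mulr1; split => // t.
  by rewrite cat_rcons E bdim_cons eq_ab eqxx mulrA.
by exists c, k.+1; split => // t; rewrite cat_rcons E bdim_cons (negbTE ne_ab).
Qed.

Lemma qdim_rcons_cons_same x a y :
  qdim q (rcons x a ++ a :: y) = qdim q (rcons x a) * qdim q (a :: y).
Proof.
have [c [k [_ E]]] := bdim_tail x a.
by rewrite -[in RHS](cats0 (rcons x a)) !E bdim_cons eqxx bdim_nil mulrA.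
Qed.

(** The Clebsch-Gordan rule for the two blocks that merge at the junction, times the contributions
    [c] and [e] of all other blocks. *)
Lemma qdim_rcons_cons_neq x a y :
  qdim q (rcons x a) * qdim q (~~ a :: y) =
  qdim q (rcons x a ++ ~~ a :: y) + qdim q x * qdim q y.
Proof.
have [c [k [Ex E]]] := bdim_tail x a.
have [l [e Ey]] := bdim_head (~~ a) y.
rewrite E -[in LHS](cats0 (rcons x a)) E bdim_nil bdim_cons.
have -> : (~~ a == a) = false by case: (a).
rewrite qdim_cons -(bdim0 (~~ a) y) !Ey Ex add0n add1n addSn.
have H := qnum_mul k l; ring: H.
Qed.

(** Follows the recursion of [fus]: a doubled letter at the junction separates blocks and forbids
    cancellation; otherwise two blocks merge. *)
Lemma qdim_fus x y : qdim q x * qdim q y = \sum_(z <- fus x y) qdim q z.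
Proof.
elim/last_ind: x y => [|x a IHx] [|b y].
- by rewrite fus1l big_seq1 qdim_nil mul1r.
- by rewrite fus1l big_seq1 qdim_nil mul1r.
- by rewrite fus1r big_seq1 qdim_nil mulr1.
rewrite fus_rcons_cons big_cons.
have [/eqP ->|] := boolP (b == ~~ a).
  by rewrite qdim_rcons_cons_neq IHx.
rewrite big_nil addr0 => ne_ba; have -> : b = a by case: (a) (b) ne_ba => [] [].
by rewrite qdim_rcons_cons_same.
Qed.

Lemma bdim_ge a k t : qnum q k.+1 <= bdim q a k t.
Proof.
elim: t a k => [|b t IHt] a k; first by rewrite bdim_nil.
rewrite bdim_cons; case: ifP => _; last exact: le_trans (qnum_leS _) (IHt _ _).
have := IHt b 1%N; have := qnum2_ge2; have := qnum_ge0 k.+1; nra.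
Qed.

Lemma bdim_le a k t : bdim q a k t <= qnum q k.+1 * qnum q 2 ^+ size t.
Proof.
have t0 : 0 <= qnum q 2 by exact: qnum_ge0.
elim: t a k => [|b t IHt] a k; first by rewrite bdim_nil mulr1.
rewrite bdim_cons /= exprS; case: ifP => _.
  by rewrite ler_wpM2l ?qnum_ge0.
apply: le_trans (IHt _ _) _; rewrite mulrA ler_wpM2r ?exprn_ge0 //.
by have := qnum_leM k 1; rewrite addn1.
Qed.

Lemma qdim_ge1 w : 1 <= qdim q w.
Proof. by rewrite -(bdim0 true) (le_trans _ (bdim_ge _ _ _)) // qnum1. Qed.

Lemma qdim_ge0 w : 0 <= qdim q w.
Proof. exact: le_trans (qdim_ge1 w). Qed.

Lemma qdim_ge_qnum2 w : (0 < size w)%N -> qnum q 2 <= qdim q w.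
Proof. by case: w => // a w _; rewrite qdim_cons bdim_ge. Qed.

Lemma qdim_le w : qdim q w <= qnum q 2 ^+ size w.
Proof. by rewrite -(bdim0 true) (le_trans (bdim_le _ _ _)) // qnum1 mul1r. Qed.

End QuantumNumbers.

(** * Words of fixed length and the growth of their volume *)

Fixpoint words (n : nat) : seq word :=
  if n is n'.+1 then map (cons true) (words n') ++ map (cons false) (words n')
  else [:: [::]].

Lemma mem_words n w : (w \in words n) = (size w == n).
Proof.
elim: n w => [|n IHn] [|b w] //; rewrite [words _]/= mem_cat.
  by apply/negbTE; rewrite negb_or; apply/andP; split; apply/negP => /mapP[].
rewrite -[size _ == _]/(size w == n) -IHn.
have cinj c : injective (cons c : word -> word) by move=> ? ? [].
have cneq : (b :: w \in [seq ~~ b :: v | v <- words n]) = false.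
  by apply/negP => /mapP[v _ []]; case: b.
by case: b cneq => /= cneq; rewrite cneq ?orbF mem_map.
Qed.

Lemma uniq_words n : uniq (words n).
Proof.
elim: n => //= n IHn; rewrite cat_uniq !map_inj_uniq ?IHn; try by move=> ? ? [].
rewrite andbT /=; apply/hasPn => _ /mapP[w _ ->]; apply/negP => /mapP[] //.
Qed.

Section Growth.
Variables (R : realType) (q : R).
Hypotheses (q_gt0 : 0 < q) (q_le1 : q <= 1).
Let s := q ^- 2 + q ^+ 2.
Let t n := qnum q n ^+ 2.

Lemma sqr_qnum2 : qnum q 2 ^+ 2 = s + 2.
Proof. by rewrite qnum2 // /s; field; exact: lt0r_neq0. Qed.

Lemma s_ge2 : 2 <= s.
Proof.
have t2 := qnum2_ge2 q_gt0 q_le1; rewrite -(lerD2r 2) -sqr_qnum2 expr2; nra.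
Qed.

Lemma PqE z : Pq q z = z ^+ 3 - (2 * s + 3) * z ^+ 2 + 2 * (s + 1) * z - 2.
Proof. by rewrite /Pq /s; ring. Qed.

Lemma exists_largest_root :
  exists r, largest_real_root q r /\ 2 * s + 1 <= r.
Proof.
pose p : {poly R} := 'X^3 - (2 * s + 3)%:P * 'X^2 + (2 * (s + 1))%:P * 'X - 2%:P.
have pE z : p.[z] = Pq q z by rewrite PqE !hornerE.
have s2 := s_ge2.
(* The cubic is negative at [2 * s + 1] and positive at [2 * s + 3]. *)
have [||r] := @poly_ivt _ p (2 * s + 1) (2 * s + 3); first by lra.
  by rewrite !pE !PqE; apply/andP; split; nra.
move=> /andP[r1 r2] /rootP; rewrite pE => Pr.

exists r; split=> //; split=> // z Pz; rewrite leNgt; apply/negP => rz.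
(* The second factor is [(P_q(z) - P_q(r)) / (z - r)]; it is positive because [z] and [r] are at
   least [2 * s + 1 >= 5]. *)
have : (z - r) * (z ^+ 2 + z * r + r ^+ 2 - (2 * s + 3) * (z + r) + 2 * (s + 1)) = 0.
  by rewrite -(subrr (0 : R)) -{1}Pz -Pr !PqE; ring.
move/eqP; rewrite mulf_eq0 subr_eq0 gt_eqF //= => /eqP.
have m1 : 0 <= z - (2 * s + 1) by lra.
have m2 : 0 <= r - (2 * s + 1) by lra.
by nra.
Qed.

(** The characteristic roots are [1], [q ^+ 2] and [q ^- 2], so three consecutive shifts of [t]
    suffice to build an eigenvector. *)
Lemma sqr_qnumS3 n : t n.+3 = (s + 1) * (t n.+2 - t n.+1) + t n.
Proof.
have -> : s = qnum q 2 ^+ 2 - 2 by rewrite sqr_qnum2; ring.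
rewrite /t (qnumSS q_gt0 q_le1 n.+1) (qnumSS q_gt0 q_le1 n) -qnum2 //; ring.
Qed.

Definition wsum (a : bool) (n k : nat) : R := \sum_(w <- words n) bdim q a k w ^+ 2.

Lemma wsum0 a k : wsum a 0 k = t k.+1.
Proof. by rewrite /wsum big_seq1 bdim_nil. Qed.

(** The next letter either repeats [a], which closes the block and opens one of length 1, or differs
    from [a] and lengthens the block. *)
Lemma wsumS a n k : wsum a n.+1 k = t k.+1 * wsum a n 1 + wsum (~~ a) n k.+1.
Proof.
have same b : \sum_(w <- words n) bdim q b k (b :: w) ^+ 2 = t k.+1 * wsum b n 1.
  by rewrite /wsum mulr_sumr; apply: eq_bigr => w _; rewrite bdim_cons eqxx exprMn.
have neq b : \sum_(w <- words n) bdim q b k (~~ b :: w) ^+ 2 = wsum (~~ b) n k.+1.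
  by apply: eq_bigr => w _; rewrite bdim_cons; case: (b).
rewrite {1}/wsum /= big_cat !big_map -same -neq.
by case: a => //=; rewrite addrC.
Qed.

Lemma sum_qdim_words n : \sum_(w <- words n.+1) qdim q w ^+ 2 =
  wsum true n 1 + wsum false n 1.
Proof. by rewrite /= big_cat !big_map. Qed.

Variable r : R.
Hypotheses (Pr : Pq q r = 0) (r_ge : 2 * s + 1 <= r).

(* A positive eigenvector, of eigenvalue [r], of the operator
   [h |-> (fun k => t k.+1 * h 1 + h k.+1)] governing [wsumS]; that the
   eigenvalue equation holds is exactly [Pq q r = 0]. *)
Definition harm (k : nat) : R :=
  (r * (r - s - 1) + s + 1) * t k.+1 + (r - s - 1) * t k.+2 + t k.+3.

(** After [t k.+4] is reduced by the recursion, the coefficients in [harm] make the [t k.+2] and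
    [t k.+3] terms cancel; the coefficient of [t k.+1] that remains is [- P_q(r)]. *)
Lemma harm_eigen k : t k.+1 * harm 1 + harm k.+1 = r * harm k.
Proof.
have t2 : t 2 = s + 2 := sqr_qnum2.
have t3 : t 3 = (s + 1) ^+ 2.
  by rewrite sqr_qnumS3 t2 /t qnum1 // qnum0; ring.
have t4 : t 4 = (s + 2) * s ^+ 2.
  by rewrite sqr_qnumS3 t3 t2 /t qnum1 //; ring.
rewrite /harm t2 t3 t4 (sqr_qnumS3 k.+1); move: Pr; rewrite PqE => P0.
apply/eqP; rewrite -subr_eq0; apply/eqP.
transitivity (- t k.+1 * (r ^+ 3 - (2 * s + 3) * r ^+ 2 + 2 * (s + 1) * r - 2)).
  ring.
by rewrite P0 mulr0.
Qed.

Lemma t_ge0 k : 0 <= t k. Proof. exact: sqr_ge0. Qed.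

Lemma t_ge1 k : 1 <= t k.+1.
Proof. by rewrite /t expr_ge1 ?qnum_ge0 ?qnum_ge1. Qed.

Lemma t_leM k l : t (k + l).+1 <= t k.+1 * t l.+1.
Proof. by rewrite /t -exprMn lerXn2r ?nnegrE ?mulr_ge0 ?qnum_ge0 ?qnum_leM. Qed.

(** The initial vector [t k.+1] lies between [harm k / M] and [harm k]; the recursion is positive,
    so it preserves both comparisons while [harm] is scaled by [r]. *)
Lemma wsum_bounds : exists c C : R, 0 < c /\ 0 < C /\
  forall a n, c * r ^+ n <= wsum a n 1 <= C * r ^+ n.
Proof.
have s2 := s_ge2.
set x := r * (r - s - 1) + s + 1; set y := r - s - 1.
have [y0 r0] : 0 <= y /\ 0 <= r.
  by rewrite /y; move: (s) s2 r_ge => s' s2' r_ge'; split; lra.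
have x1 : 1 <= x by rewrite /x -/y; have := mulr_ge0 r0 y0; move: (s) s2 => s'; lra.
have harmE k : harm k = x * t k.+1 + y * t k.+2 + t k.+3 by [].
clearbody x y.
(* Comes from [t k.+2 <= t 2 * t k.+1] and [t k.+3 <= t 3 * t k.+1]. *)
pose M := x + y * t 2 + t 3.
have M0 : 1 <= M by rewrite /M; have := t_ge0 3; have := mulr_ge0 y0 (t_ge0 2); lra.
have harm_lo k : t k.+1 <= harm k.
  rewrite harmE; have := mulr_ge0 y0 (t_ge0 k.+2); have := t_ge0 k.+3.
  by have := ler_peMl (t_ge0 k.+1) x1; lra.
have harm_hi k : harm k <= M * t k.+1.
  rewrite harmE /M !mulrDl; apply: lerD; last first.
    by have := t_leM 2 k; rewrite add2n.
  apply: lerD => //; rewrite -(mulrA y) ler_wpM2l //.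
  by have := t_leM 1 k; rewrite add1n.
have up a n k : wsum a n k <= r ^+ n * harm k.
  elim: n a k => [|n IHn] a k; first by rewrite wsum0 mul1r.
  rewrite wsumS exprSr -mulrA -harm_eigen mulrDr lerD // mulrCA.
  by rewrite ler_wpM2l ?t_ge0.
have lo a n k : r ^+ n * harm k <= M * wsum a n k.
  elim: n a k => [|n IHn] a k; first by rewrite wsum0 mul1r.
  rewrite wsumS exprSr -mulrA -harm_eigen [leLHS]mulrDr [leRHS]mulrDr.
  apply: lerD; last exact: IHn.
  by rewrite mulrCA [leRHS]mulrCA ler_wpM2l ?t_ge0.
have h1 : 1 <= harm 1 by exact: le_trans (t_ge1 1) (harm_lo 1%N).
exists M^-1, (harm 1); split; first by rewrite invr_gt0; lra.
split; first by lra.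
move=> a n; apply/andP; split; last by rewrite mulrC up.
rewrite mulrC ler_pdivrMr; last by lra.
by rewrite [leRHS]mulrC (le_trans _ (lo a n 1%N)) // ler_peMr ?exprn_ge0.
Qed.

End Growth.

(** * Supports of products and balls *)

(** Associativity moves the brackets; this cuts a long product of generators into two shorter
    ones. *)
Lemma foldl_fusl_split r ys z : z \in foldl fusl r ys ->
  exists b c, [/\ b \in r, c \in Defs.fprod ys & z \in fus b c].
Proof.
elim/last_ind: ys z => [|ys y IHys] z.
  by exists z, [::]; rewrite fus1r !mem_seq1.
rewrite foldl_rcons => /flatten_mapP[w /IHys[b [c [br cys wbc]]] zwy].
have [c' c'cy zbc'] := fus_assoc wbc zwy; exists b, c'; split => //.
by rewrite /Defs.fprod foldl_rcons; apply/flatten_mapP; exists c.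
Qed.

Lemma flatten_fprod xs : flatten xs \in Defs.fprod xs.
Proof.
elim/last_ind: xs => // xs x IHxs.
rewrite /Defs.fprod foldl_rcons flatten_rcons; apply/flatten_mapP; exists (flatten xs) => //.
by apply/fusP; exists (flatten xs), [::], x; rewrite cats0.
Qed.

Lemma fprod_size_le xs z : z \in Defs.fprod xs -> (size z <= sumn (map size xs))%N.
Proof.
elim/last_ind: xs z => [|xs x IHxs] z; first by rewrite mem_seq1 => /eqP ->.
rewrite /Defs.fprod foldl_rcons => /flatten_mapP[w /IHxs + /fusP[u [c [v [wE -> ->]]]]].
rewrite {}wE map_rcons sumn_rcons !size_cat size_wbar addnA leq_add2r.
by move=> /(leq_trans (leq_addr _ _)) /leq_trans -> //; exact: leq_addr.
Qed.

(** Each cancellation removes [c] and its conjugate, hence an even number of letters. *)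
Lemma fprod_size_even xs z : z \in Defs.fprod xs ->
  all (fun x => ~~ odd (size x)) xs -> ~~ odd (size z).
Proof.
elim/last_ind: xs z => [|xs x IHxs] z; first by rewrite mem_seq1 => /eqP ->.
rewrite /Defs.fprod foldl_rcons all_rcons => /flatten_mapP[w /IHxs].
move=> + /fusP[u [c [v [wE -> ->]]]] /andP[+ xs_even] => /(_ xs_even).
by rewrite wE !size_cat size_wbar !oddD; case: odd; case: odd; case: odd.
Qed.

Lemma mem_seqs_of X m xs :
  (xs \in seqs_of X m) = (size xs == m) && all (fun x => x \in X) xs.
Proof.
elim: m xs => [|m IHm] xs; first by case: xs.
apply/allpairsP/andP => [[[x s] /= [xX + ->]]|].
  by rewrite IHm /= xX eqSS => /andP[-> ->].
case: xs => [|x s] /= [//]; rewrite eqSS => sm /andP[xX sX].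
by exists (x, s); rewrite IHm sm.
Qed.

Lemma ballP X n a :
  reflect (exists xs, [/\ (size xs <= n)%N, all (fun x => x \in X) xs & a \in Defs.fprod xs])
          (a \in ballX X n).
Proof.
rewrite /ballX mem_undup; apply: (iffP idP) => [|[xs [sxs xsX axs]]].
  rewrite in_cons => /orP[/eqP ->|]; first by exists [::].
  case/flatten_mapP=> m; rewrite mem_iota add1n ltnS => /andP[_ mn].
  case/flatten_mapP=> xs; rewrite mem_seqs_of => /andP[/eqP sxs xsX] axs.
  by exists xs; rewrite sxs.
rewrite in_cons; case: xs sxs xsX axs => [|x xs] sxs xsX axs.
  by rewrite mem_seq1 in axs; rewrite axs.
apply/orP; right; apply/flatten_mapP; exists (size xs).+1.
  by rewrite mem_iota add1n ltnS.
by apply/flatten_mapP; exists (x :: xs); rewrite // mem_seqs_of eqxx.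
Qed.

Lemma ler_sum_subset (R : numDomainType) (T : eqType) (s1 s2 : seq T) (f : T -> R) :
  (forall x, 0 <= f x) -> uniq s1 -> {subset s1 <= s2} ->
  \sum_(x <- s1) f x <= \sum_(x <- s2) f x.
Proof.
move=> f0; elim: s1 s2 => [|x s1 IHs1] s2; first by rewrite big_nil sumr_ge0.
move=> /= /andP[xs1 us1] s12; rewrite big_cons [leRHS](big_rem x) ?s12 ?mem_head //=.
rewrite lerD2l IHs1 // => y ys1.
have : y \in s2 by rewrite s12 // in_cons ys1 orbT.
rewrite (perm_mem (perm_to_rem (s12 x (mem_head _ _)))) in_cons => /orP[/eqP yx|//].
by rewrite -yx ys1 in xs1.
Qed.

(** * Substituting an odd word and its conjugate for the letters *)

Definition subst (x : word) (w : word) : word :=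
  flatten [seq if b then x else wbar x | b <- w].

Lemma count_wbar x : (count id (wbar x) = size x - count id x)%N.
Proof.
rewrite count_rev count_map -(count_predC id x) addKn.
by apply: eq_count.
Qed.

(** Conjugation exchanges the numbers of the two letters; a self-conjugate word has equally many of
    each. *)
Lemma wbar_odd_neq x : odd (size x) -> x != wbar x.
Proof.
apply: contraL => /eqP xx; have := count_wbar x; rewrite -xx.
have := count_size id x => le eqc.
suff -> : size x = (count id x).*2 by rewrite odd_double.
by rewrite -addnn {2}eqc subnKC.
Qed.

(** The images of the two letters are distinct and equally long, so the word can be decoded from the
    left. *)
Lemma subst_inj x : odd (size x) -> injective (subst x).
Proof.
move=> xodd; have x0 : (0 < size x)%N by case: x xodd.
have szx (b : bool) : size (if b then x else wbar x) = size x.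
  by case: b; rewrite ?size_wbar.
have nil b w : (if b then x else wbar x) ++ subst x w <> [::].
  by move=> /(congr1 size); rewrite size_cat szx /=; case: size x0.
elim=> [|b w IHw] [|b' w'] //.
- by move=> /esym /nil.
- by move=> /nil.
rewrite /subst /= -/(subst x w) -/(subst x w') => /eqP.
rewrite eqseq_cat ?szx // => /andP[bb' /eqP /IHw ->]; congr cons.
have ne := negbTE (wbar_odd_neq xodd).
by case: b b' bb' => [] [] //; rewrite ?ne // eq_sym ne.
Qed.

Lemma not_alternating (x : word) : ~~ sorted (fun a b => a != b) x ->
  exists u a v, x = u ++ [:: a, a & v].
Proof.
elim: x => // a [|b x] IHx //=; rewrite negb_and negbK => /orP[/eqP ->|/IHx].
  by exists [::], b, x.
by move=> [u [c [v ->]]]; exists (a :: u), c, v.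
Qed.

Lemma last_alternating a (x : word) : path (fun a b => a != b) a x ->
  last a x = a (+) odd (size x).
Proof.
elim: x a => [|b x IHx] a /=; first by rewrite addbF.
by move=> /andP[ab /IHx ->]; case: a b ab (odd _) => [] [] // _ [].
Qed.

(** * Dimension under substitution and volumes of balls *)

Section Volume.
Variables (R : realType) (q : R).
Hypotheses (q_gt0 : 0 < q) (q_le1 : q <= 1).

Lemma bdim_alternating a k (x : word) y : path (fun a b => a != b) a x ->
  bdim q a k (x ++ y) = bdim q (last a x) (k + size x) y.
Proof.
elim: x a k => [|b x IHx] a k /=; first by rewrite addn0.
move=> /andP[ab xb]; rewrite bdim_cons eq_sym (negbTE ab) IHx //.
by rewrite addSnnS.
Qed.

(** An alternating word of odd length begins and ends with the same letter, so blocks of [w] go to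
    blocks of the image, only longer. *)
Lemma qdim_subst_alternating x w : odd (size x) -> sorted (fun a b => a != b) x ->
  qdim q w <= qdim q (subst x w).
Proof.
case: x => // p x' xodd xalt; set x := p :: x' in xodd xalt *.
(* The common first and last letter of the image of [b]. *)
pose sg b := b (+) ~~ p.
have xb (b : bool) : exists2 z, (if b then x else wbar x) = sg b :: z &
    path (fun a b => a != b) (sg b) z /\ ~~ odd (size z).
  have walt : sorted (fun a b => a != b) (wbar x).
    rewrite rev_sorted sorted_map; apply: sub_sorted xalt => a c /=.
    by case: a c => [] [].
  case: b; first by rewrite (_ : sg true = p); [exists x'|rewrite /sg; case: (p)].
  have whead : head true (wbar x) = sg false.
    rewrite /wbar /sg addFb -nth0 nth_rev ?size_map // subn1.
    rewrite -(size_map negb) nth_last /= last_map (last_alternating xalt).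
    by move: xodd => /= /negbTE ->; rewrite addbF.
  case: (wbar x) (size_wbar x) whead walt => //= b z sz -> zalt.
  by exists z => //; case: sz => ->.
(* The open block of the image may be longer than that of [w], hence the two lengths [k <= K]. *)
have main t a k K : (k <= K)%N -> bdim q a k t <= bdim q (sg a) K (subst x t).
  elim: t a k K => [|b t IHt] a k K kK; first by rewrite !bdim_nil qnum_le.
  rewrite /subst /= -/(subst x t); have [z -> [zalt zeven]] := xb b.
  have zlast : last (sg b) z = sg b by rewrite last_alternating // (negbTE zeven) addbF.
  rewrite cat_cons !bdim_cons !bdim_alternating // zlast /sg (inj_eq (can_inj (addbK _))).
  case: ifP => _; last by rewrite IHt // addSn ltnS (leq_trans kK) ?leq_addr.
  by rewrite ler_pM ?qnum_ge0 ?IHt ?qnum_le // (le_trans _ (bdim_ge _ _ _ _ _)) ?qnum_ge0.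
by have := main w true 0%N 0%N isT; rewrite !bdim0.
Qed.

(* Each of the [size w] copies is cut at its doubled letter, where [qdim] is
   multiplicative; every nonempty piece has dimension at least [qnum q 2]. *)
Lemma qdim_subst_double u a v w :
  qdim q w <= qdim q (subst (u ++ [:: a, a & v]) w).
Proof.
set x := u ++ _; have t2 := qnum2_ge2 q_gt0 q_le1.
have xb (b : bool) : exists u a v, (if b then x else wbar x) = u ++ [:: a, a & v].
  case: b; first by exists u, a, v.
  exists (wbar v), (~~ a), (wbar u).
  by rewrite /x wbar_cat -[[:: a, a & v]]/([:: a; a] ++ v) wbar_cat -catA.
(* The prefix [t] stands for what the previous cut leaves over; if nonempty it supplies one more
   factor [[2]]. *)
have main t : qnum q 2 ^+ (size w + (0 < size t)) <= qdim q (t ++ subst x w).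
  elim: w t => [|b w IHw] t.
    rewrite cats0 add0n; case: posnP => [_|t0]; first by rewrite qdim_ge1.
    by rewrite expr1 qdim_ge_qnum2.
  rewrite /subst /= -/(subst x w); have [u' [a' [v' ->]]] := xb b.
  have -> : t ++ (u' ++ [:: a', a' & v']) ++ subst x w =
    rcons (t ++ u') a' ++ a' :: (v' ++ subst x w) by rewrite cat_rcons -!catA.
  rewrite qdim_rcons_cons_same //.
  apply: (@le_trans _ _ (qnum q 2 * qnum q 2 ^+ (size w).+1)).
    rewrite -exprS ler_weXn2l //; first by lra.
    by rewrite addSn ltnS -[leqRHS](addn1 (size w)) leq_add2l leq_b1.
  rewrite ler_pM ?exprn_ge0 ?qnum_ge0 ?qdim_ge_qnum2 ?size_rcons //.
  by have := IHw (a' :: v'); rewrite addn1.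
apply: le_trans (qdim_le q_gt0 q_le1 w) _.
by have := main [::]; rewrite addn0.
Qed.

Lemma qdim_subst x w : odd (size x) -> qdim q w <= qdim q (subst x w).
Proof.
move=> xodd; have [xalt|/not_alternating[u [a [v ->]]]] :=
  boolP (sorted (fun a b => a != b) x).
  exact: qdim_subst_alternating.
exact: qdim_subst_double.
Qed.

Lemma gen_set_odd X : gen_set X -> exists2 x, x \in X & odd (size x).
Proof.
move=> [_ /(_ [:: true])[xs [/allP xsX /fprod_size_even xs_even]]].
apply/hasP; apply: contraT => /hasPn Xeven; suff /xs_even : all (fun x => ~~ odd (size x)) xs by [].
by apply/allP => x /xsX /Xeven.
Qed.

Lemma vol_ball_ge X n : gen_set X ->
  \sum_(w <- words n) qdim q w ^+ 2 <= vol q (ballX X n).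
Proof.
move=> gX; have [x xX xodd] := gen_set_odd gX.
apply: (@le_trans _ _ (\sum_(w <- map (subst x) (words n)) qdim q w ^+ 2)).
  rewrite big_map; apply: ler_sum => w _.
  by rewrite lerXn2r ?nnegrE ?qdim_ge0 ?qdim_subst.
apply: ler_sum_subset => [w||_ /mapP[w wn ->]]; first exact: sqr_ge0.
  by rewrite map_inj_uniq ?uniq_words //; exact: subst_inj.
apply/ballP; exists [seq if b then x else wbar x | b <- w].
split; last exact: flatten_fprod.
  by rewrite size_map; move: wn; rewrite mem_words => /eqP ->.
by apply/allP => _ /mapP[[] _ ->] //; apply: gX.1.
Qed.

(** Cancellation only shortens, so a product of at most [n] letters contains only words of length at
    most [n]. *)
Lemma vol_ball_letters_le n :
  vol q (ballX [:: [:: true]; [:: false]] n) <=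
  \sum_(0 <= j < n.+1) \sum_(w <- words j) qdim q w ^+ 2.
Proof.
rewrite -(big_map words xpredT (fun s => \sum_(w <- s) qdim q w ^+ 2)) -big_flatten.
apply: ler_sum_subset => [w||w]; first exact: sqr_ge0; first exact: undup_uniq.
move=> /ballP[xs [sxs xsX /fprod_size_le wle]].
apply/flatten_mapP; exists (size w); last by rewrite mem_words.
rewrite mem_index_iota ltnS /= (leq_trans wle) // (leq_trans _ sxs) //.
elim: xs xsX {sxs wle} => //= x xs IHxs /andP[xX /IHxs].
by move: xX; rewrite !in_cons orbF => /orP[] /eqP -> /=; rewrite add1n ltnS.
Qed.

Lemma gen_set_letters : gen_set [:: [:: true]; [:: false]].
Proof.
split=> [x|a]; first by rewrite !inE => /orP[] /eqP ->.
exists [seq [:: b] | b <- a]; split; first by apply/allP => _ /mapP[[] _ ->].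
by have := flatten_fprod [seq [:: b] | b <- a]; rewrite flatten_seq1.
Qed.

Lemma sum_sqr_le (T : Type) (s : seq T) (f : T -> R) : (forall x, 0 <= f x) ->
  \sum_(x <- s) f x ^+ 2 <= (\sum_(x <- s) f x) ^+ 2.
Proof.
move=> f0; elim: s => [|x s IHs]; first by rewrite !big_nil expr0n.
rewrite !big_cons sqrrD -addrA lerD2l (le_trans IHs) // lerDr.
by rewrite mulrn_wge0 // mulr_ge0 // sumr_ge0.
Qed.

(** Each element of the larger ball occurs in some [fus b c] with [b], [c] in the smaller ones, and
    the squared dimensions in [fus b c] sum to at most the square of their sum,
    [(qdim q b * qdim q c) ^+ 2]. *)
Lemma vol_ballD X m n :
  vol q (ballX X (m + n)) <= vol q (ballX X m) * vol q (ballX X n).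
Proof.
rewrite /vol mulr_suml.
apply: (@le_trans _ _ (\sum_(b <- ballX X m) \sum_(c <- ballX X n)
    \sum_(z <- fus b c) qdim q z ^+ 2)); last first.
  apply: ler_sum => b _; rewrite mulr_sumr; apply: ler_sum => c _.
  by rewrite -exprMn qdim_fus // sum_sqr_le // => z; exact: qdim_ge0.
have -> : \sum_(b <- ballX X m) \sum_(c <- ballX X n) \sum_(z <- fus b c) qdim q z ^+ 2 =
  \sum_(z <- flatten [seq fus b c | b <- ballX X m, c <- ballX X n]) qdim q z ^+ 2.
  by rewrite big_flatten big_allpairs_dep.
apply: ler_sum_subset => [w||a]; first exact: sqr_ge0; first exact: undup_uniq.
move=> /ballP[xs [sxs xsX]]; rewrite -(cat_take_drop m xs) /Defs.fprod foldl_cat.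
rewrite -(cat_take_drop m xs) all_cat in xsX; case/andP: xsX => X1 X2.
move=> /foldl_fusl_split[b [c [bm cn abc]]].
apply/flattenP; exists (fus b c) => //; apply: (allpairs_f fus).
  by apply/ballP; exists (take m xs); split=> //; rewrite size_take_min geq_minl.
by apply/ballP; exists (drop m xs); split=> //; rewrite size_drop leq_subLR.
Qed.

End Volume.

(** * Limits of subadditive sequences *)

Section Limits.
Local Open Scope classical_set_scope.
Variable R : realType.
Implicit Types (s : nat -> R) (a b l : R).

Lemma cvg_cst_divn a : (a / n%:R) @[n --> \oo] --> (0 : R).
Proof.
apply/cvgrPdist_le => e e0; near=> n.
have n0 : (0 < n)%N by near: n; exact: nbhs_infty_gt.
rewrite sub0r normrN normrM normfV normr_nat ler_pdivrMr ?ltr0n //.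
by rewrite mulrC -ler_pdivrMr //; near: n; exact: nbhs_infty_ger.
Unshelve. all: by end_near.
Qed.

Lemma cvg_affine_divn a b : ((a + n%:R * b) / n%:R) @[n --> \oo] --> b.
Proof.
rewrite -[X in _ --> X]add0r; have /cvgD := cvg_cst_divn a; move=> /(_ _ _ (cvg_cst b)).
apply: cvg_trans; apply: near_eq_cvg; near=> n.
have n0 : (0 < n)%N by near: n; exact: nbhs_infty_gt.
by rewrite /= mulrDl mulrAC divff ?mul1r // pnatr_eq0 -lt0n.
Unshelve. all: by end_near.
Qed.

(* Fekete's lemma *)
Lemma subadditive_cvg s : (forall n, 0 <= s n) ->
  (forall m n, s (m + n)%N <= s m + s n) -> cvgn (fun n => s n / n%:R).
Proof.
move=> s0 sD.
have sMD j m i : s (j * m + i)%N <= j%:R * s m + s i.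
  elim: j => [|j IHj]; first by rewrite mul0n mul0r add0r.
  rewrite mulSn -addnA (le_trans (sD _ _)) // -addn1 natrD mulrDl mul1r.
  by rewrite [leRHS]addrAC [leRHS]addrC lerD2l.
pose A := [set s n / n%:R | n in [set n | (0 < n)%N]].
have A0 x : A x -> 0 <= x by move=> [n _ <-]; rewrite divr_ge0.
have infA : has_inf A.
  by split; [exists (s 1%N / 1), 1%N | exists 0 => x /A0].
apply/cvg_ex; exists (inf A); apply/cvgrPdist_le => e e0.
have [|x [m /= m0 <-] xlt] := @inf_adherent _ A (e / 2) _ infA; first by rewrite divr_gt0.
(* Bounds [s] at every remainder modulo [m]; divided by [n] it becomes negligible. *)
pose M := \sum_(i < m) s i.
near=> n.
have n0 : (0 < n)%N by near: n; exact: nbhs_infty_gt.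
have nR : 0 < n%:R :> R by rewrite ltr0n.
have mR : 0 < m%:R :> R by rewrite ltr0n.
have le1 : inf A <= s n / n%:R.
  by apply: ge_inf; [exact: infA.2 | exists n].
rewrite ler0_norm ?subr_le0 // opprB lerBlDr.
have le2 : s n <= n%:R * (s m / m%:R) + M.
  rewrite {1}(divn_eq n m) (le_trans (sMD _ _ _)) // lerD //.
    rewrite mulrCA mulrC ler_wpM2l // ler_pdivlMr // -natrM ler_nat.
    by rewrite leq_trunc_div.
  rewrite /M (bigD1 (Ordinal (ltn_pmod n m0))) //= lerDl sumr_ge0 //.
have le3 : M / n%:R <= e / 2.
  rewrite ler_pdivrMr // mulrC -ler_pdivrMr ?divr_gt0 //.
  by near: n; exact: nbhs_infty_ger.
have le4 : s n / n%:R <= s m / m%:R + M / n%:R.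
  by rewrite ler_pdivrMr // mulrDl divfK ?gt_eqF // mulrC.
lra.
Unshelve. all: by end_near.
Qed.

End Limits.

(** * The exponential growth rate *)

Section Rate.
Variables (R : realType) (q : R).
Hypotheses (q_gt0 : 0 < q) (q_le1 : q <= 1).
Local Open Scope classical_set_scope.

Lemma vol_ball_ge1 X n : 1 <= vol q (ballX X n).
Proof.
have : [::] \in ballX X n by apply/ballP; exists [::].
rewrite /vol => /(big_rem _) -> /=; rewrite qdim_nil expr1n lerDl.
by apply: sumr_ge0 => w _; exact: sqr_ge0.
Qed.

(** Submultiplicative volumes at least 1 have nonnegative subadditive logarithms; growth rates can
    then be compared through logarithms. *)
Lemma omegaX_cvg X : exists2 l : R, omegaX q X = expR l &
  (ln (vol q (ballX X n)) / n%:R) @[n --> \oo] --> l.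
Proof.
pose v n := vol q (ballX X n).
have v0 n : 0 < v n by rewrite (lt_le_trans ltr01) ?vol_ball_ge1.
have /cvg_ex[l vl] : cvgn (fun n => ln (v n) / n%:R).
  apply: subadditive_cvg => [n|m n]; first by rewrite ln_ge0 ?vol_ball_ge1.
  by rewrite -lnM ?posrE // ler_ln ?posrE ?mulr_gt0 ?vol_ballD.
exists l => //; apply/cvg_lim => //.
have : expR (ln (v n) / n%:R) @[n --> \oo] --> expR l.
  by apply: continuous_cvg => //; exact: continuous_expR.
apply: cvg_trans; apply: near_eq_cvg; near=> n.
by rewrite /= /powR (gt_eqF (v0 n)) mulrC.
Unshelve. all: by end_near.
Qed.

Lemma omegaX_ge X (r c : R) : 0 < r -> 0 < c ->
  (forall n, c * r ^+ n <= vol q (ballX X n.+1)) -> r <= omegaX q X.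
Proof.
move=> r0 c0 cle; have [l -> vl] := omegaX_cvg X.
rewrite -[r]lnK ?posrE // ler_expR.
(* Passing from [n.+1] to [n] turns the constant into [c / r], which has no effect in the limit. *)
apply: (ler_cvg_to (@cvg_affine_divn _ (ln (c / r)) (ln r)) vl); near=> n.
have n0 : (0 < n)%N by near: n; exact: nbhs_infty_gt.
rewrite ler_wpM2r ?invr_ge0 // mulr_natl -lnXn // -lnM ?posrE ?divr_gt0 ?exprn_gt0 //.
rewrite ler_ln ?posrE ?mulr_gt0 ?invr_gt0 ?exprn_gt0 //.
  by rewrite -(prednK n0) exprS mulrA divfK ?gt_eqF.
by rewrite (lt_le_trans ltr01) ?vol_ball_ge1.
Unshelve. all: by end_near.
Qed.

Lemma omegaX_le X (r c : R) : 0 < r -> 0 < c ->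
  (forall n, vol q (ballX X n) <= c * r ^+ n) -> omegaX q X <= r.
Proof.
move=> r0 c0 cle; have [l -> vl] := omegaX_cvg X.
rewrite -[r]lnK ?posrE // ler_expR.
apply: (ler_cvg_to vl (@cvg_affine_divn _ (ln c) (ln r))); near=> n.
rewrite ler_wpM2r ?invr_ge0 // mulr_natl -lnXn // -lnM ?posrE ?exprn_gt0 //.
rewrite ler_ln ?posrE ?mulr_gt0 ?exprn_gt0 //.
by rewrite (lt_le_trans ltr01) ?vol_ball_ge1.
Unshelve. all: by end_near.
Qed.

Lemma omega_largest_root : exists r, largest_real_root q r /\ omega q = r /\ 1 < r.
Proof.
have [r [rroot r_ge]] := exists_largest_root q_gt0 q_le1; exists r.
have s2 := s_ge2 q_gt0 q_le1.
have r2 : 2 <= r by lra.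
have r0 : 0 < r by lra.
have [c [C [c0 [C0 cC]]]] := wsum_bounds q_gt0 q_le1 rroot.1 r_ge.
have lower X : gen_set X -> r <= omegaX q X.
  move=> gX; apply: (omegaX_ge (c := c)) => // n.
  apply: le_trans (vol_ball_ge q_gt0 q_le1 n.+1 gX).
  have /andP[lt _] := cC true n; have /andP[lf _] := cC false n.
  rewrite sum_qdim_words; have := mulr_ge0 (ltW c0) (exprn_ge0 n (ltW r0)); lra.
have upper : omegaX q [:: [:: true]; [:: false]] <= r.
  (* The 1 accounts for the empty word and [2 * C] for the two possible first letters; [r >= 2] then
     carries the induction. *)
  apply: (omegaX_le (c := 1 + 2 * C)); [by []|lra|] => n.
  apply: le_trans (vol_ball_letters_le _ _) _.
  elim: n => [|n IHn].
    by rewrite big_nat1 big_seq1 qdim_nil expr1n expr0; lra.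
  rewrite big_nat_recr //= sum_qdim_words exprS.
  have /andP[_ lt] := cC true n; have /andP[_ lf] := cC false n.
  move: (r ^+ n) (exprn_ge0 n (ltW r0)) IHn lt lf => a a0 IHn lt lf.
  have Cr : 0 <= (1 + 2 * C) * (r - 2) by rewrite mulr_ge0 //; lra.
  have := mulr_ge0 Cr a0; lra.
split=> //; split; last by lra.
have letters : [set omegaX q X | X in [set X : seq word | gen_set X]]
    (omegaX q [:: [:: true]; [:: false]]).
  by exists [:: [:: true]; [:: false]] => //; exact: gen_set_letters.
(* The two letters give the upper bound, and [r] is a lower bound over all generating sets. *)
apply/le_anti/andP; split.
  apply: le_trans upper; apply: ge_inf => //.
  by exists r => _ [X gX <-]; exact: lower.
apply: lb_le_inf; first by exists (omegaX q [:: [:: true]; [:: false]]).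
by move=> _ [X gX <-]; exact: lower.
Qed.

End Rate.

Theorem theorem7p7 (R : realType) (N : nat) (F : 'M[R[i]]_N) (q : R) :
  (2 <= N)%N ->
  F \in unitmx ->
  \tr (adjmx F *m F) = \tr (invmx (adjmx F *m F)) ->
  0 < q -> q <= 1 ->
  real_complex R (q + q^-1) = \tr (adjmx F *m F) ->
  exists r : R, largest_real_root q r /\ omega q = r /\ 1 < r.
Proof. by move=> _ _ _ q_gt0 q_le1 _; exact: omega_largest_root. Qed.
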